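(* The set of all strongly mixing maps in $C(\lambda)$ is of the first category (meager) in the metric space $(C(\lambda),\rho)$.
   Context: $\lambda$ is the Lebesgue measure on $[0,1]$, $\mathcal B$ the Borel $\sigma$-algebra of $[0,1]$. $C(\lambda)$ is the set of all continuous maps $f\colon[0,1]\to[0,1]$ with $\lambda(A)=\lambda(f^{-1}(A))$ for all $A\in\mathcal B$, equipped with the complete metric $\rho(f,g)=\sup_{x\in[0,1]}|f(x)-g(x)|$. A map $f\in C(\lambda)$ is strongly mixing if for every $A,B\in\mathcal B$, $\lim_{n\to\infty}\lambda(f^{-n}(A)\cap B)=\lambda(A)\lambda(B)$. *)

(* Defs.v *)
From HB Require Import structures.
From mathcomp Require Import all_boot all_order all_algebra.
From mathcomp Require Import all_classical all_reals all_analysis.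
From mathcomp Require Import lra.

Set Implicit Arguments.
Unset Strict Implicit.
Unset Printing Implicit Defensive.

Import Order.TTheory GRing.Theory Num.Theory.
Import numFieldNormedType.Exports.

Local Open Scope classical_set_scope.
Local Open Scope ring_scope.

Section category.
Variable T : topologicalType.

Definition nowhere_dense (A : set T) := interior (closure A) = set0.

Definition meager (A : set T) :=
  exists F : (set T)^nat, (forall n, nowhere_dense (F n)) /\ A = \bigcup_n F n.

End category.

Definition unit_itv (R : realType) : Type := set_type `[0 : R, 1].

(* [set_type A] carries the initial topology of its inclusion, i.e. the
   subspace topology. *)
HB.instance Definition _ (R : realType) :=
  PseudoMetric.copy (unit_itv R) (set_type `[0 : R, 1]).

Section unit_interval.
Variable R : realType.
Local Notation I := (unit_itv R).

Definition unit_itv_val (x : I) : R := set_val x.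

Lemma unit_itv_valP (x : I) : 0 <= unit_itv_val x <= 1.
Proof. by have := set_valP x; rewrite /= in_itv. Qed.

Lemma unit_itv_val_inj : injective unit_itv_val.
Proof. exact: val_inj. Qed.

Lemma unit_itv0_subproof : (0 : R) \in `[0 : R, 1]%classic.
Proof. by rewrite mem_set//= in_itv/= lexx ler01. Qed.

Definition unit_itv0 : I := exist _ 0 unit_itv0_subproof.

HB.instance Definition _ := isPointed.Build I unit_itv0.

HB.instance Definition _ := @isMeasurable.Build (sigma_display (@open I)) I
  <<s @open I >> (@sigma_algebra0 _ setT _) (@sigma_algebraC I _)
  (@sigma_algebra_bigcup _ setT _).

Lemma measurable_unit_itv_image (A : set I) :
  measurable A -> measurable (unit_itv_val @` A).
Proof.
have rangeE : range unit_itv_val = `[0, 1]%classic.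
  apply/seteqP; split=> [_ [x _ <-]|x x01]; first exact: set_valP.
  by exists (exist _ x (mem_set x01)).
move=> mA; apply: (mA [set B : set I | measurable (unit_itv_val @` B)]).
split; [split=> [|B mB|F mF] /=|].
- by rewrite image_set0.
- have -> : unit_itv_val @` (setT `\` B) =
            `[0, 1]%classic `\` unit_itv_val @` B.
    rewrite -rangeE; apply/seteqP; split=> [_ [x [_ Bx] <-]|_ [[x _ <-] nBx]].
      split; first by exists x.
      by move=> [y By /unit_itv_val_inj yx]; apply: Bx; rewrite -yx.
    by exists x => //; split=> // Bx; apply: nBx; exists x.
  by apply: measurableD => //; exact: measurable_itv.
- by rewrite image_bigcup; apply: bigcup_measurable => n _; exact: mF.
- move=> U [V oV <-] /=.
  rewrite [X in measurable X](_ : _ = `[0, 1]%classic `&` V).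
    apply: measurableI; first exact: measurable_itv.
    exact: measurable_realfun.open_measurable.
  apply/seteqP; split=> [_ [x Vx <-]|x [x01 Vx]].
    by split=> //; exact: set_valP.
  by exists (exist _ x (mem_set x01)).
Qed.

Definition lambda (A : set I) : \bar R :=
  @lebesgue_measure R (unit_itv_val @` A).

Let lambda0 : lambda set0 = 0%E.
Proof. by rewrite /lambda image_set0 measure0. Qed.

Let lambda_ge0 A : (0 <= lambda A)%E.
Proof. exact: measure_ge0. Qed.

Let lambda_sigma_additive : semi_sigma_additive lambda.
Proof.
move=> F mF tF mUF; rewrite /lambda image_bigcup.
apply: measure_semi_sigma_additive.
- by move=> n; exact: measurable_unit_itv_image.
- apply/trivIsetP => i j _ _ ij; apply/seteqP; split=> // _ [[x Fx <-]].
  move=> [y Fy /unit_itv_val_inj yx]; move: Fy; rewrite yx => Fy.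
  move/trivIsetP : tF => /(_ i j Logic.I Logic.I ij) Fij.
  by have : set0 x by rewrite -Fij.
- by rewrite -image_bigcup; exact: measurable_unit_itv_image.
Qed.

HB.instance Definition _ := isMeasure.Build _ I R lambda
  lambda0 lambda_ge0 lambda_sigma_additive.

Let lambda_setT : lambda setT = 1%E.
Proof.
rewrite /lambda; have -> : range unit_itv_val = `[0, 1]%classic.
  apply/seteqP; split=> [_ [x _ <-]|x x01]; first exact: set_valP.
  by exists (exist _ x (mem_set x01)).
by rewrite lebesgue_measure_itv/= lte01 oppr0 adde0.
Qed.

HB.instance Definition _ := Measure_isProbability.Build _ I R lambda lambda_setT.

Record C_lambda := MkClambda {
  C_lambda_fun :> I -> I ;
  C_lambda_continuous : continuous C_lambda_fun ;
  C_lambda_preserving : forall A : set I, measurable A ->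
    lambda A = lambda (C_lambda_fun @^-1` A) }.

Lemma C_lambda_eq (f g : C_lambda) : f =1 g -> f = g.
Proof.
case: f g => [f cf pf] [g cg pg] /= /funext fg; subst g.
by congr MkClambda; exact: Prop_irrelevance.
Qed.

HB.instance Definition _ := gen_eqMixin C_lambda.
HB.instance Definition _ := gen_choiceMixin C_lambda.

Definition rho (f g : C_lambda) : R :=
  sup [set `|unit_itv_val (f x) - unit_itv_val (g x)| | x in [set: I]].

Let rho_has_sup (f g : I -> I) :
  has_sup [set `|unit_itv_val (f x) - unit_itv_val (g x)| | x in [set: I]].
Proof.
split; first by eexists; exists unit_itv0.
exists 1 => _ [x _ <-].
have /andP[f0 f1] := unit_itv_valP (f x).
have /andP[g0 g1] := unit_itv_valP (g x).
by rewrite ler_norml; apply/andP; split; lra.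
Qed.

Let rho_ub (f g : C_lambda) x :
  `|unit_itv_val (f x) - unit_itv_val (g x)| <= rho f g.
Proof. by apply: ub_le_sup; [case: (rho_has_sup f g)|exists x]. Qed.

Let rho_le (f g : C_lambda) e :
  (forall x, `|unit_itv_val (f x) - unit_itv_val (g x)| <= e) -> rho f g <= e.
Proof.
move=> h; apply: ge_sup; first by case: (rho_has_sup f g).
by move=> _ [x _ <-].
Qed.

Let rhoxx f : rho f f = 0.
Proof.
apply/eqP; rewrite eq_le; apply/andP; split.
  by apply: rho_le => x; rewrite subrr normr0.
exact: le_trans (rho_ub f f unit_itv0).
Qed.

Let rho_positivity f g : rho f g = 0 -> f = g.
Proof.
move=> fg0; apply: C_lambda_eq => x; apply: unit_itv_val_inj.
by apply/eqP; rewrite -subr_eq0 -normr_le0 -fg0; exact: rho_ub.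
Qed.

Let rho_sym f g : rho f g = rho g f.
Proof. by congr sup; apply: eq_imagel => x _; rewrite distrC. Qed.

Let rho_triangle g f h : rho f h <= rho f g + rho g h.
Proof.
apply: rho_le => x.
rewrite (le_trans (ler_distD (unit_itv_val (g x)) _ _))//.
exact: lerD (rho_ub _ _ _) (rho_ub _ _ _).
Qed.

HB.instance Definition _ := isMetric.Build R C_lambda
  rhoxx rho_positivity rho_sym rho_triangle.

Definition strongly_mixing (f : C_lambda) := forall A B : set I,
  measurable A -> measurable B ->
  lambda (iter n f @^-1` A `&` B) @[n --> \oo] --> (lambda A * lambda B)%E.

End unit_interval.

(* Main.v *)
From HB Require Import structures.
Require Import Defs.
From mathcomp Require Import all_boot all_order all_algebra perm fingroup.
From mathcomp Require Import all_classical all_reals all_analysis.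
From mathcomp Require Import measurable_realfun.
From mathcomp Require Import ring lra zify.

(** If [f] is strongly mixing and [A] is the left half of the interval, the
    measure of the set of points of [A] that are in [A] again at time [k] tends
    to [1 / 4]. So the strongly mixing maps are covered by the sets of those for
    which this measure is at most [1 / 3] for all [k >= n], one set for each
    [n]. Each of them is nowhere dense, because every [f] has arbitrarily close
    to it an open set of maps for which the measure exceeds [1 / 3] at some time
    [k >= n] ([robust_recurrence]).

    To find such maps, cut the interval into many blocks of equal length. As [f]
    preserves measure, Hall's marriage theorem ([hall_marriage]) gives a
    permutation [s] of the blocks such that [f] sends some point of each block
    [i] into the block [s i] ([block_permutation]). Some power of [s], with an
    exponent [k >= n], is the identity. Now modify [f] on each block [i]: run
    through the values of [f] very fast, in a proportion [eta] of the time, and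
    spend the remaining time in a loop that starts from the common point of the
    image of block [i] and of block [s i], covers block [s i] uniformly and
    returns to its start ([loop_exists], [insert_loop]). The modified map is
    continuous, close to [f], and preserves measure: the fast parts contribute
    [eta] times the image measure of [f], which is [eta] times [lambda], and the
    loops contribute [1 - eta] times [lambda], because [s] is a permutation
    ([loop_approximation]).

    The new map sends nearly all of block [i] into block [s i], and so does any
    map of [C_lambda] close enough to it, since only the points that land near
    the ends of the blocks may miss their target block ([block_leak]). As all these maps
    preserve measure, the losses of [k] successive steps simply add up
    ([block_tracking]). Taking [eta], and then the distance, small compared with
    [1 / k], nearly all points of [A] are in [A] again at time [k]
    ([block_recurrence]). *)

Set Implicit Arguments.
Unset Strict Implicit.
Unset Printing Implicit Defensive.

Import Order.TTheory GRing.Theory Num.Theory.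
Import numFieldNormedType.Exports.

Local Open Scope classical_set_scope.
Local Open Scope ring_scope.

(** * Hall's marriage theorem *)

Section hall.
Local Open Scope nat_scope.
Variables (T U : finType) (e : T -> U -> bool).

Definition neighbours (A : {set T}) : {set U} :=
  [set y | [exists x in A, e x y]].

Lemma neighboursP (A : {set T}) y :
  reflect (exists2 x, x \in A & e x y) (y \in neighbours A).
Proof. by rewrite inE; exact: exists_inP. Qed.

Lemma neighboursU (A B : {set T}) :
  neighbours (A :|: B) = neighbours A :|: neighbours B.
Proof.
apply/finset.setP => y; rewrite finset.in_setU; apply/neighboursP/orP.
  by move=> [x]; rewrite inE => /orP[] ? ?; [left|right];
    apply/neighboursP; exists x.
by move=> [] /neighboursP[x xA exy]; exists x => //; rewrite inE xA ?orbT.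
Qed.

(** Hall's marriage theorem, with the set [V] of admissible partners as a
    parameter so that the induction on [S] can remove partners already used.
    If some proper nonempty part [A] of [S] has no partner to spare, [A] and
    its complement are matched separately, the latter avoiding the partners of
    [A]; otherwise one pair can be matched arbitrarily, since every other part
    keeps enough partners after losing one. The point [y0] is only a value for
    the matching outside [S]. *)
Lemma hall_marriage (y0 : U) (S : {set T}) (V : {set U}) :
  (forall A : {set T}, A \subset S -> #|A| <= #|neighbours A :&: V|) ->
  exists2 f : T -> U, {in S &, injective f} &
    forall x, x \in S -> e x (f x) && (f x \in V).
Proof.
move: {2}#|S| (leqnn #|S|) => n; elim: n S V => [|n IH] S V.
  rewrite leqn0 cards_eq0 => /eqP -> _.
  by exists (fun=> y0) => [x y|x]; rewrite inE.
move=> Sn hallS.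
have [->|[x xS]] := finset.set_0Vmem S.
  by exists (fun=> y0) => [x y|x]; rewrite inE.
have [/existsP[A /and4P[AS A0 AnS crit]]|noncrit] :=
  boolP [exists A : {set T}, [&& A \subset S, A != finset.set0, A != S &
                              #|neighbours A :&: V| <= #|A|]].
  have pAS : A \proper S by rewrite finset.properEneq AnS.
  have ltA := proper_card pAS.
  have A_gt0 : 0 < #|A| by rewrite card_gt0.
  have cSA := cardsID A S; rewrite (finset.setIidPr AS) in cSA.
  have [|B BA|f1 f1i f1e] := IH A V; first by lia.
    exact/hallS/(fintype.subset_trans BA).
  have [| B BSA |f2 f2i f2e] := IH (S :\: A) (V :\: neighbours A).
    by lia.
    have BS : B \subset S.
      by rewrite (fintype.subset_trans BSA)// finset.subsetDl.
    have dAB : A :&: B = finset.set0.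
      apply/finset.setP => z; rewrite !inE; apply/negbTE/negP => /andP[zA zB].
      by have := fintype.subsetP BSA _ zB; rewrite inE zA.
    have ABS : A :|: B \subset S by rewrite finset.subUset AS.
    have := hallS _ ABS; rewrite neighboursU finset.setIUl cardsU dAB.
    rewrite cards0 subn0.
    have -> : neighbours A :&: V :|: neighbours B :&: V =
      (neighbours A :&: V) :|: (neighbours B :&: (V :\: neighbours A)).
      apply/finset.setP => z.
      rewrite !(finset.in_setU, finset.in_setI, finset.in_setD).
      by do !case: (z \in _).
    by rewrite cardsU; lia.
  have disj z t : z \in A -> t \in S :\: A -> f1 z != f2 t.
    move=> zA /f2e /andP[_]; rewrite finset.in_setD => /andP[+ _].
    apply: contraNneq => <-; apply/neighboursP; exists z => //.
    by case/andP: (f1e z zA).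
  exists (fun x => if x \in A then f1 x else f2 x).
    move=> a b aS bS /=; case: ifPn => aA; case: ifPn => bA.
    - exact: f1i.
    - by move/eqP; rewrite (negbTE (disj _ _ _ _))// inE bA.
    - by move/esym/eqP; rewrite (negbTE (disj _ _ _ _))// inE aA.
    - by apply: f2i; rewrite inE ?aA ?bA.
  move=> a aS /=; case: ifPn => aA; first exact: f1e.
  have /f2e /andP[-> ] : a \in S :\: A by rewrite inE aA.
  by rewrite inE => /andP[].
have [y yxV] : exists y, y \in neighbours [set x]%SET :&: V.
  apply/card_gt0P; rewrite (leq_trans _ (hallS [set x]%SET _)) ?cards1//.
  by rewrite finset.sub1set.
move: yxV; rewrite finset.in_setI => /andP[].
move=> /neighboursP[_ /finset.set1P -> exy] yV.
have cSx := cardsD1 x S; rewrite xS in cSx.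
have [| B BSx |f fi fe] := IH (S :\ x) (V :\ y).
  by lia.
  have BS : B \subset S by rewrite (fintype.subset_trans BSx)// finset.subsetDl.
  have [->|B0] := eqVneq B finset.set0; first by rewrite cards0.
  have BnS : B != S.
    apply: contraTneq BSx => ->; apply/negP => /fintype.subsetP /(_ _ xS).
    by rewrite !inE eqxx.
  move: noncrit; rewrite negb_exists => /forallP /(_ B).
  rewrite BS B0 BnS /= -ltnNge => BV.
  have : neighbours B :&: V \subset y |: (neighbours B :&: (V :\ y)).
    apply/fintype.subsetP => z.
    rewrite !(finset.in_setU1, finset.in_setI, finset.in_setD1) => /andP[-> ->].
    by case: (z == y).
  by move/subset_leq_card; rewrite cardsU1; case: (_ \notin _); lia.
exists (fun z => if z == x then y else f z).
  move=> a b aS bS /=; case: eqVneq => ax; case: eqVneq => bx.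
  - by rewrite ax bx.
  - move=> yf; have /fe : b \in S :\ x by rewrite !inE bx.
    by rewrite -yf !inE eqxx andbF.
  - move=> yf; have /fe : a \in S :\ x by rewrite !inE ax.
    by rewrite yf !inE eqxx andbF.
  - by apply: fi; rewrite !inE ?ax ?bx.
move=> a aS /=; case: eqVneq => [->|ax]; first by rewrite exy.
have /fe /andP[->] : a \in S :\ x by rewrite !inE ax.
by rewrite inE => /andP[].
Qed.

End hall.

(** * Occupation measures of paths *)

Section affine_change_of_variable.
Variable R : realType.
Local Notation mu := (@lebesgue_measure R).
Implicit Types (A : set R).

Lemma continuous_affine (r b : R) : continuous (fun x : R => r * x + b).
Proof.
by move=> x; apply: cvgD; [exact: mulrl_continuous|exact: cvg_cst].
Qed.

Lemma lebesgue_measure_affine (r b : R) A : 0 < r -> measurable A ->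
  mu ((fun x => r * x + b) @^-1` A) = (r^-1%:E * mu A)%E.
Proof.
move=> r0 mA.
have mf : measurable_fun [set: measurableTypeR R]
    ((fun x => r * x + b) : measurableTypeR R -> measurableTypeR R).
  by apply: continuous_measurable_fun => x; exact: continuous_affine.
pose rn : {nonneg R} := NngNum (ltW r0).
pose f : measurableTypeR R -> measurableTypeR R := fun x => r * x + b.
pose nu : {measure set (measurableTypeR R) -> \bar R} :=
  mscale rn (pushforward mu f).
suff -> : mu A = nu mf A.
  rewrite /nu /mscale/= muleA -EFinM mulVf ?mul1e//; exact: lt0r_neq0.
apply: lebesgue_measure_unique => // _ [[u v]] _ <-.
rewrite [RHS](_ : _ = (r%:E * mu (f @^-1` `]u, v]))%E)//.
have -> : f @^-1` `]u, v] = `]((u - b) / r), ((v - b) / r)]%classic.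
  apply/seteqP; split => x /=; rewrite !in_itv/=;
  by rewrite ltr_pdivrMr// ler_pdivlMr// ltrBlDr lerBrDr mulrC.
rewrite !lebesgue_measure_itv/= !lte_fin ltr_pM2r ?invr_gt0// ltrD2r.
case: ifP => _; last by rewrite mule0.
rewrite -!EFinB -EFinM; congr EFin; field; exact: lt0r_neq0.
Qed.

End affine_change_of_variable.

Section occupation.
Variable R : realType.
Local Notation mu := (@lebesgue_measure R).
Implicit Types (f g : R -> R) (A : set R).

(** Time spent in [A] by the path [g] during the interval from [c] to [d].
    Half-open intervals make it exactly additive under concatenation. *)
Definition occupation g c d A : R := fine (mu (`[c, d[ `&` g @^-1` A)).

Lemma measurable_preimage_continuous g A :
  continuous g -> measurable A -> measurable (g @^-1` A).
Proof.
move=> cg mA; rewrite -[X in measurable X]setTI.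
exact: (continuous_measurable_fun cg).
Qed.

Lemma occupation_measurable g c d A : continuous g -> measurable A ->
  measurable (`[c, d[ `&` g @^-1` A).
Proof.
move=> cg mA; apply: measurableI => //.
exact: measurable_preimage_continuous.
Qed.

Lemma occupationE g c d A : continuous g -> measurable A ->
  (occupation g c d A)%:E = mu (`[c, d[ `&` g @^-1` A).
Proof.
move=> cg mA; rewrite fineK// ge0_fin_numE//.
apply: (@le_lt_trans _ _ (mu `[c, d[)).
  by apply: le_measure; rewrite ?inE//; exact: occupation_measurable.
by rewrite lebesgue_measure_itv/=; case: ifP => // _; rewrite -EFinB ltry.
Qed.

Lemma eq_occupation g1 g2 c d A : (forall x, c <= x < d -> g1 x = g2 x) ->
  occupation g1 c d A = occupation g2 c d A.
Proof.
move=> h; rewrite /occupation; congr (fine (mu _)).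
by apply/seteqP; split => x /= []; rewrite in_itv/= => xcd; rewrite h.
Qed.

Lemma occupation_split g c e d A : continuous g -> measurable A ->
  c <= e -> e <= d ->
  occupation g c d A = occupation g c e A + occupation g e d A.
Proof.
move=> cg mA ce ed; apply: EFin_inj; rewrite EFinD !occupationE//.
rewrite -measureU//; [|exact: occupation_measurable..|].
  congr (mu _); rewrite -setIUl; congr (_ `&` _).
  by apply: itv_bndbnd_setU; rewrite bnd_simp.
apply/seteqP; split => // x /= [[+ _] [+ _]].
by rewrite !in_itv/= => /andP[_ xe] /andP[+ _]; rewrite leNgt xe.
Qed.

Lemma occupation_affine g r b c d A : continuous g -> measurable A -> 0 < r ->
  occupation (fun x => g (r * x + b)) c d A =
  r^-1 * occupation g (r * c + b) (r * d + b) A.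
Proof.
move=> cg mA r0; have cl := @continuous_affine R r b.
apply: EFin_inj; rewrite EFinM !occupationE//; last first.
  by move=> x; apply: (@continuous_comp _ _ _ (fun x => r * x + b) g);
    [exact: cl|exact: cg].
rewrite -(lebesgue_measure_affine b)//; last exact: occupation_measurable.
congr (mu _); apply/seteqP; split => x /= [];
by rewrite !in_itv/= lerD2r ltrD2r ler_pM2l// ltr_pM2l.
Qed.

Lemma le_lebesgue_measure_set1 A B (a : R) : measurable A -> measurable B ->
  A `<=` B `|` [set a] -> (mu A <= mu B)%E.
Proof.
move=> mA mB AB; rewrite -(@measureU0 _ _ _ mu B [set a])//.
  by apply: le_measure => //; rewrite inE//; exact: measurableU.
exact: lebesgue_measure_set1.
Qed.

Lemma occupation_opp g c d A : continuous g -> measurable A ->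
  occupation (fun x => g (- x)) c d A = occupation g (- d) (- c) A.
Proof.
move=> cg mA; have cN : continuous (fun x => g (- x)).
  move=> x; apply: (@continuous_comp _ _ _ -%R g); last exact: cg.
  exact: oppr_continuous.
apply: EFin_inj; rewrite !occupationE//.
have -> : `[c, d[ `&` (fun x => g (- x)) @^-1` A =
    -%R @^-1` (`]- d, - c] `&` g @^-1` A).
  apply/seteqP; split => x /= [];
  by rewrite !in_itv/= lerN2 ltrN2 andbC.
have mB : measurable (`]- d, - c] `&` g @^-1` A).
  by apply: measurableI => //; exact: measurable_preimage_continuous.
have := lebesgue_measureN mB; rewrite /pushforward => ->.
apply/eqP; rewrite eq_le; apply/andP; split.
  apply: (@le_lebesgue_measure_set1 _ _ (- c)) => //.
    exact: occupation_measurable.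
  move=> x [] /=; rewrite !in_itv/= => /andP[xd].
  by rewrite le_eqVlt (ltW xd) => /orP[/eqP ->|->]; [right|left].
apply: (@le_lebesgue_measure_set1 _ _ (- d)) => //.
  exact: occupation_measurable.
move=> x [] /=; rewrite !in_itv/= => /andP[+ xc].
by rewrite le_eqVlt (ltW xc) andbT => /orP[/eqP ->|->]; [right|left].
Qed.


Lemma occupation_antitone g r b c d A : continuous g -> measurable A -> 0 < r ->
  occupation (fun x => g (b - r * x)) c d A =
  r^-1 * occupation g (b - r * d) (b - r * c) A.
Proof.
move=> cg mA r0.
rewrite (@eq_occupation _ (fun x => g (- (r * x + - b)))); last first.
  by move=> x _; rewrite opprB.
have cN : continuous (fun x => g (- x)).
  move=> x; apply: (@continuous_comp _ _ _ -%R g); last exact: cg.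
  exact: oppr_continuous.
rewrite (@occupation_affine (fun x => g (- x)))// occupation_opp//.
by rewrite !opprB.
Qed.

End occupation.

(** * Insertion of a loop into a path *)

Section loop_insertion.
Variable R : realType.
Implicit Types (f g : R -> R) (A : set R).

Definition glue f e g := fun x => if x <= e then f x else g x.

Lemma glueL f e g x : x <= e -> glue f e g x = f x.
Proof. by rewrite /glue => ->. Qed.

Lemma glueR f e g x : f e = g e -> e <= x -> glue f e g x = g x.
Proof.
rewrite /glue => fg ex; case: ifPn => // xe.
by rewrite (@le_anti _ _ x e)// ex xe.
Qed.

Lemma continuous_glue f e g : continuous f -> continuous g -> f e = g e ->
  continuous (glue f e g).
Proof.
move=> cf cg fg.
(* Composing with min and max turns the case distinction into a sum. *)
have -> : glue f e g = fun x => f (Num.min x e) + (g (Num.max x e) - g e).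
  apply/funext => x; rewrite /glue; case: (leP x e) => xe.
    by rewrite subrr addr0.
  by rewrite fg addrC subrK.
move=> x; apply: cvgD.
  apply: (@continuous_comp _ _ _ (fun x => Num.min x e) f); last exact: cf.
  by apply: continuous_min => //; exact: cvg_cst.
apply: cvgB; last exact: cvg_cst.
apply: (@continuous_comp _ _ _ (fun x => Num.max x e) g); last exact: cg.
by apply: continuous_max => //; exact: cvg_cst.
Qed.

Lemma occupation_glue f e g c d A : continuous f -> continuous g ->
  f e = g e -> measurable A -> c <= e -> e <= d ->
  occupation (glue f e g) c d A = occupation f c e A + occupation g e d A.
Proof.
move=> cf cg fg mA ce ed; rewrite (@occupation_split _ _ _ e)//; last first.
  exact: continuous_glue.
congr (_ + _); apply: eq_occupation => x /andP[x1 x2].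
  by rewrite glueL// ltW.
by rewrite glueR.
Qed.

(** A triangular wave of one period and constant speed, started at [p], passes
    exactly twice over each point between [u] and [v]: it climbs from [p] to
    [v], descends to [u] and climbs back to [p]. Its occupation measure is
    therefore uniform whatever the base point is. *)
Lemma loop_exists a T u v p : 0 < T -> u < v -> u <= p <= v ->
  exists l : R -> R, [/\ continuous l, l a = p, l (a + T) = p,
    (forall x, a <= x <= a + T -> u <= l x <= v) &
    forall A, measurable A ->
      occupation l a (a + T) A = T / (v - u) * occupation id u v A].
Proof.
move=> T0 uv /andP[up pv].
have vu0 : 0 < v - u by rewrite subr_gt0.
pose s := 2 * (v - u) / T.
have s0 : 0 < s by rewrite divr_gt0// mulr_gt0.
pose e1 := a + (v - p) / s; pose e2 := e1 + (v - u) / s.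
have sE x y z : y = x + z / s -> s * y = s * x + z.
  by move=> ->; rewrite mulrDr mulrCA divff ?mulr1// gt_eqF.
have se1 : s * e1 = s * a + (v - p) by exact: sE.
have se2 : s * e2 = s * a + (v - p) + (v - u) by rewrite -se1; exact: sE.
have sb : s * (a + T) = s * a + 2 * (v - u).
  by rewrite mulrDr; congr (_ + _); rewrite /s divfK// gt_eqF.
have sle x y : x <= y -> s * x <= s * y by rewrite ler_pM2l.
have sle' x y : s * x <= s * y -> x <= y by rewrite ler_pM2l.
have ae1 : a <= e1 by apply: sle'; lra.
have e12 : e1 <= e2 by apply: sle'; lra.
have e2b : e2 <= a + T by apply: sle'; lra.
pose l1 x := s * x + (p - s * a).
pose l2 x := v + s * e1 - s * x.
pose l3 x := s * x + (u - s * e2).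
have c1 : continuous l1 by exact: continuous_affine.
have c3 : continuous l3 by exact: continuous_affine.
have c2 : continuous l2.
  by move=> x; apply: cvgB; [exact: cvg_cst|exact: mulrl_continuous].
have m12 : l1 e1 = l2 e1 by rewrite /l1 /l2; lra.
have m23 : l2 e2 = l3 e2 by rewrite /l2 /l3; lra.
pose l23 := glue l2 e2 l3.
have c23 : continuous l23 by exact: continuous_glue.
have m123 : l1 e1 = l23 e1 by rewrite /l23 glueL.
exists (glue l1 e1 l23); split.
- exact: continuous_glue.
- by rewrite glueL// /l1; lra.
- rewrite glueR ?(le_trans e12)// /l23 glueR// /l3; lra.
- move=> x /andP[ax xb].
  have /sle sax := ax; have /sle sxb := xb.
  case: (leP x e1) => [xe1|/ltW e1x].
    by rewrite glueL// /l1; move/sle: xe1 => ?; apply/andP; split; lra.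
  rewrite glueR//; have /sle se1x := e1x.
  case: (leP x e2) => [xe2|/ltW e2x].
    by rewrite /l23 glueL// /l2; move/sle: xe2 => ?; apply/andP; split; lra.
  have /sle se2x := e2x.
  by rewrite /l23 glueR// /l3; apply/andP; split; lra.
- move=> A mA; have cid : continuous (@id R) by move=> ?.
  rewrite occupation_glue// ?(le_trans e12)// occupation_glue//.
  rewrite (@occupation_affine _ id)// (@occupation_antitone _ id)//.
  rewrite (@occupation_affine _ id)//.
  have -> : s * a + (p - s * a) = p by lra.
  have -> : s * e1 + (p - s * a) = v by lra.
  have -> : v + s * e1 - s * e2 = u by lra.
  have -> : v + s * e1 - s * e1 = v by lra.
  have -> : s * e2 + (u - s * e2) = u by lra.
  have -> : s * (a + T) + (u - s * e2) = p by lra.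
  rewrite [in RHS](@occupation_split _ _ _ p)//.
  rewrite [occupation id u v A](@occupation_split _ _ _ p)//.
  rewrite /s; field; rewrite !gt_eqF//.
Qed.

(** The path [f] between [c] and [d] is run at speed [1 / eta], with a pause at
    the point [z], and the time gained is spent in a loop through [f z] that
    covers a block of the same length uniformly. The endpoints do not move, so
    insertions on adjacent intervals are compatible; and if [f] and the loops
    both have uniform total occupation, so has the modified path. *)
Lemma insert_loop f c d z u v eta : continuous f -> c < d -> c <= z <= d ->
  v - u = d - c -> u <= f z <= v -> 0 < eta < 1 ->
  exists g, [/\ continuous g,
    (forall x, x <= c -> g x = f x),
    (forall x, d <= x -> g x = f x),
    (forall x, c <= x <= d ->
       (exists2 y, c <= y <= d & g x = f y) \/ u <= g x <= v) &
    forall A, measurable A -> occupation g c d A =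
      eta * occupation f c d A + (1 - eta) * occupation id u v A].
Proof.
move=> cf cd /andP[cz zd] vu ufzv /andP[eta0 eta1].
pose a := c + eta * (z - c); pose T := (1 - eta) * (d - c).
have T0 : 0 < T by rewrite mulr_gt0// subr_gt0.
(* The run before the pause ends at [a] and the run after it starts at [b]. *)
have [|l [cl la lb lr lo]] := @loop_exists a T u v (f z) T0 _ ufzv.
  by rewrite -subr_gt0 vu subr_gt0.
set b := a + T in lb lr lo.
pose s := eta^-1.
have s0 : 0 < s by rewrite invr_gt0.
have seta : s * eta = 1 by rewrite mulVf// gt_eqF.
have ca : c <= a by rewrite lerDl mulr_ge0 ?(ltW eta0)// subr_ge0.
have ab : a <= b by rewrite lerDl ltW.
have db : d - b = eta * (d - z) by rewrite /b /a /T; ring.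
have bd : b <= d.
  by rewrite -subr_ge0 db mulr_ge0 ?(ltW eta0)// subr_ge0.
pose f1 x := f (s * x + (c - s * c)); pose f2 x := f (s * x + (d - s * d)).
have sa : s * a + (c - s * c) = z.
  by rewrite /a mulrDr mulrA seta; lra.
have sb : s * b + (d - s * d) = z.
  have -> : b = d - eta * (d - z) by rewrite -db; lra.
  by rewrite mulrBr mulrA seta; lra.
have ccomp k : continuous (fun x => f (s * x + k)).
  move=> x; apply: (@continuous_comp _ _ _ (fun x => s * x + k) f).
    exact: continuous_affine.
  exact: cf.
have cf1 : continuous f1 by exact: ccomp.
have cf2 : continuous f2 by exact: ccomp.
have mc : f c = f1 c by rewrite /f1; congr f; lra.
have ma : f1 a = l a by rewrite /f1 sa la.
have mb : l b = f2 b by rewrite /f2 sb lb.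
have md : f2 d = f d by rewrite /f2; congr f; lra.
pose g4 := glue f2 d f; pose g3 := glue l b g4; pose g2 := glue f1 a g3.
have c4 : continuous g4 by exact: continuous_glue.
have m4 : l b = g4 b by rewrite /g4 glueL.
have c3 : continuous g3 by exact: continuous_glue.
have m3 : f1 a = g3 a by rewrite /g3 glueL.
have c2 : continuous g2 by exact: continuous_glue.
have m2 : f c = g2 c by rewrite /g2 glueL.
have sle x y : x <= y -> s * x <= s * y by rewrite ler_pM2l.
exists (glue f c g2); split.
- exact: continuous_glue.
- by move=> x xc; rewrite glueL.
- move=> x dx; have bx := le_trans bd dx; have ax := le_trans ab bx.
  have cx := le_trans ca ax.
  by rewrite glueR// /g2 glueR// /g3 glueR// /g4 glueR.
- move=> x /andP[cx xd]; rewrite glueR//.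
  case: (leP x a) => [xa|/ltW ax].
    left; rewrite /g2 glueL//; exists (s * x + (c - s * c)) => //.
    have := sle _ _ cx; have := sle _ _ xa; move: sa zd cd; clear.
    by move=> *; apply/andP; split; lra.
  rewrite /g2 glueR//; case: (leP x b) => [xb|/ltW bx].
    by right; rewrite /g3 glueL// lr// ax.
  rewrite /g3 glueR// /g4 glueL//; left; exists (s * x + (d - s * d)) => //.
  have := sle _ _ bx; have := sle _ _ xd; move: sb cz cd; clear.
  by move=> *; apply/andP; split; lra.
- move=> A mA; rewrite (@eq_occupation _ _ g2); last first.
    by move=> x /andP[cx _]; rewrite glueR.
  rewrite occupation_glue// ?(le_trans ab)// occupation_glue//.
  rewrite [occupation g4 _ _ _](@eq_occupation _ _ f2); last first.
    by move=> x /andP[_ xd]; rewrite /g4 glueL// ltW.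
  rewrite lo// !occupation_affine// sa sb.
  have -> : s * c + (c - s * c) = c by lra.
  have -> : s * d + (d - s * d) = d by lra.
  rewrite (@occupation_split _ f c z d)// vu /T /s invrK.
  field; rewrite gt_eqF// subr_gt0//.
Qed.

End loop_insertion.

(** * Loops on all cells of a grid *)

Section loop_insertion_grid.
Variable R : realType.
Implicit Types (f g : R -> R) (A : set R).
Local Notation mu := (@lebesgue_measure R).

Lemma occupation_ge0 g c d A : 0 <= occupation g c d A.
Proof. by rewrite fine_ge0. Qed.

Lemma occupation_le_length g c d A : continuous g -> measurable A -> c <= d ->
  occupation g c d A <= d - c.
Proof.
move=> cg mA cd; rewrite -lee_fin occupationE//.
apply: (@le_trans _ _ (mu `[c, d[)).
  by apply: le_measure; rewrite ?inE//; exact: occupation_measurable.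
rewrite lebesgue_measure_itv/= lte_fin; case: ifPn => // _.
by rewrite lee_fin subr_ge0.
Qed.

Lemma occupation_grid g w N A : continuous g -> measurable A -> 0 <= w ->
  occupation g 0 (N%:R * w) A =
  \sum_(i < N) occupation g (i%:R * w) (i.+1%:R * w) A.
Proof.
move=> cg mA w0; elim: N => [|N IH].
  rewrite big_ord0 mul0r; apply/eqP; rewrite eq_le occupation_ge0 andbT.
  by have := occupation_le_length cg mA (lexx 0); rewrite subrr.
rewrite big_ord_recr/= -IH; apply: occupation_split => //.
  by rewrite mulr_ge0.
by rewrite ler_wpM2r// ler_nat.
Qed.

(** The hypothesis on [z] and [u] says that [f] meets the block based at [u i]
    during the [i]-th cell. Loops are inserted cell by cell from the left. *)
Lemma insert_loops f w eta N (z u : nat -> R) : continuous f -> 0 < w ->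
  0 < eta < 1 ->
  (forall i, (i < N)%N -> i%:R * w <= z i <= i.+1%:R * w) ->
  (forall i, (i < N)%N -> u i <= f (z i) <= u i + w) ->
  exists g, [/\ continuous g,
    (forall i x, (i < N)%N -> i%:R * w <= x <= i.+1%:R * w ->
       (exists2 y, i%:R * w <= y <= i.+1%:R * w & g x = f y) \/
       u i <= g x <= u i + w) &
    forall i A, (i < N)%N -> measurable A ->
      occupation g (i%:R * w) (i.+1%:R * w) A =
      eta * occupation f (i%:R * w) (i.+1%:R * w) A +
      (1 - eta) * occupation id (u i) (u i + w) A].
Proof.
move=> cf w0 eta01 zP uP.
(* The path is unchanged to the right of the cells already treated, so the
   crossing data of the next cells are still valid for it. *)
suff [g [cg gf gr go]] : exists g, [/\ continuous g,
    (forall x, N%:R * w <= x -> g x = f x),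
    (forall i x, (i < N)%N -> i%:R * w <= x <= i.+1%:R * w ->
       (exists2 y, i%:R * w <= y <= i.+1%:R * w & g x = f y) \/
       u i <= g x <= u i + w) &
    forall i A, (i < N)%N -> measurable A ->
      occupation g (i%:R * w) (i.+1%:R * w) A =
      eta * occupation f (i%:R * w) (i.+1%:R * w) A +
      (1 - eta) * occupation id (u i) (u i + w) A].
  by exists g; split.
elim: N zP uP => [|N IH] zP uP.
  by exists f; split => //.
have [||g [cg gf gr go]] := IH.
  by move=> i iN; apply: zP; rewrite ltnW.
  by move=> i iN; apply: uP; rewrite ltnW.
have xlt (i j : nat) : (i <= j)%N -> i%:R * w <= j%:R * w.
  by move=> ij; rewrite ler_pM2r// ler_nat.
have dE : N.+1%:R * w = N%:R * w + w by rewrite -natr1 mulrDl mul1r.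
have zN := zP N (ltnSn N).
have gzN : g (z N) = f (z N) by apply: gf; case/andP: zN.
have := @insert_loop R g (N%:R * w) (N.+1%:R * w) (z N) (u N) (u N + w) eta cg.
case=> //.
- by rewrite dE ltrDl.
- by rewrite dE; lra.
- by rewrite gzN; exact: uP.
move=> h [ch hl hr hb ho]; exists h; split => //.
- by move=> x Nx; rewrite hr// gf// (le_trans _ Nx)// xlt.
- move=> i x; rewrite ltnS leq_eqVlt => /orP[/eqP -> xN|iN xi].
    have [[y yN hgy]|] := hb _ xN; last by right.
    by left; exists y => //; rewrite hgy gf//; case/andP: yN.
  have xN : x <= N%:R * w by case/andP: xi => _ /le_trans; apply; exact: xlt.
  by rewrite hl//; exact: gr.
- move=> i A; rewrite ltnS leq_eqVlt => /orP[/eqP -> mA|iN mA].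
    rewrite ho//; congr (_ * _ + _); apply: eq_occupation => x /andP[Nx _].
    exact: gf.
  rewrite -go//; apply: eq_occupation => x /andP[_ xi]; apply: hl.
  by rewrite (le_trans (ltW xi))// xlt.
Qed.

End loop_insertion_grid.

(** * From paths on the real line to self-maps of the unit interval *)

Section unit_itv_transfer.
Variable R : realType.
Local Notation I := (unit_itv R).
Local Notation val := (@unit_itv_val R).
Implicit Types (A : set I) (h : I -> I).

Lemma clamp_subproof (x : R) :
  Num.max 0 (Num.min x 1) \in `[0 : R, 1]%classic.
Proof.
by rewrite mem_set//= in_itv/= le_max lexx/= ge_max ler01 ge_min lexx orbT.
Qed.

Definition clamp (x : R) : I :=
  exist _ (Num.max 0 (Num.min x 1)) (clamp_subproof x).

Lemma val_clamp x : 0 <= x <= 1 -> val (clamp x) = x.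
Proof.
move=> /andP[x0 x1]; have -> : val (clamp x) = Num.max 0 (Num.min x 1) by [].
by rewrite (min_idPl x1) (max_idPr x0).
Qed.

Lemma clamp_val x : clamp (val x) = x.
Proof. by apply: unit_itv_val_inj; rewrite val_clamp// unit_itv_valP. Qed.

Lemma continuous_val : continuous val.
Proof. exact: initial_continuous. Qed.

Lemma continuous_clamp : continuous clamp.
Proof.
apply: continuous_comp_initial => x.
change {for x, continuous (fun x : R => Num.max 0 (Num.min x 1))}.
apply: continuous_max; first exact: cvg_cst.
by apply: continuous_min => //; exact: cvg_cst.
Qed.

Lemma measurable_preimage_unit_itv h A : continuous h -> measurable A ->
  measurable (h @^-1` A).
Proof.
move=> ch mA; apply: (mA [set B : set I | measurable (h @^-1` B)]).
split; [split=> [|B mB|F mF] /=|].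
- by rewrite preimage_set0.
- by rewrite setTD -preimage_setC; exact: measurableC.
- by rewrite preimage_bigcup; apply: bigcup_measurable => n _; exact: mF.
- move=> U oU /=; apply: sub_sigma_algebra.
  by apply: open_comp oU => x _; exact: ch.
Qed.

Lemma measurable_preimage_val (B : set R) : open B -> measurable (val @^-1` B).
Proof.
move=> oB; apply: sub_sigma_algebra.
by apply: open_comp oB => x _; exact: continuous_val.
Qed.

Lemma measurable_preimage_val_itv (c d : R) :
  measurable (val @^-1` `[c, d[).
Proof.
have -> : val @^-1` `[c, d[ = val @^-1` `]-oo, d[ `\` val @^-1` `]-oo, c[.
  apply/seteqP; split => x /=; rewrite !in_itv/=.
    by move=> /andP[cx ->]; split => //; apply/negP; rewrite -leNgt.
  by move=> [-> /negP]; rewrite -leNgt => ->.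
by apply: measurableD; apply: measurable_preimage_val; exact: lray_open.
Qed.

(** Measures of preimages under a self-map of the unit interval are occupation
    times of the path that it describes; occupation ignores the time [1], which
    is negligible. *)
Lemma lambda_preimage h (g : R -> R) A : continuous h -> continuous g ->
  measurable A -> (forall x, val (h x) = g (val x)) ->
  lambda (h @^-1` A) = (occupation g 0 1 (val @` A))%:E.
Proof.
move=> ch cg mA hg; have mvA := measurable_unit_itv_image mA.
have mhA := measurable_unit_itv_image (measurable_preimage_unit_itv ch mA).
rewrite occupationE//; apply/eqP; rewrite eq_le; apply/andP; split.
  apply: (@le_lebesgue_measure_set1 _ _ _ 1) => //.
    exact: occupation_measurable.
  move=> _ [x Ahx <-]; have /andP[x0 x1] := unit_itv_valP x.
  have [->|xn1] := eqVneq (val x) 1; [by right|left; split => /=].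
    by rewrite in_itv/= x0 lt_neqAle xn1.
  by rewrite -hg; exists (h x).
apply: le_measure; rewrite ?inE//; first exact: occupation_measurable.
move=> x [] /=; rewrite in_itv/= => /andP[x0 x1] [y Ay yg].
have x01 : 0 <= x <= 1 by rewrite x0 ltW.
exists (clamp x); last exact: val_clamp.
suff : h (clamp x) = y by move=> hy; rewrite /preimage/= hy.
by apply: unit_itv_val_inj; rewrite hg val_clamp.
Qed.

Lemma lambdaE A : measurable A -> lambda A = (occupation id 0 1 (val @` A))%:E.
Proof. by move=> mA; apply: (@lambda_preimage id id A _ _ mA) => // x. Qed.

Lemma lambda_val_itv c d : 0 <= c -> c <= d -> d <= 1 ->
  lambda (val @^-1` `[c, d[) = (d - c)%:E.
Proof.
move=> c0 cd d1; rewrite /lambda (_ : val @` _ = `[c, d[%classic).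
  rewrite lebesgue_measure_itv/= lte_fin -EFinB; case: ltP => // dc.
  by rewrite (@le_anti _ _ c d) ?cd// subrr.
apply/seteqP; split => [_ [x xcd <-]//|x xcd].
move: (xcd); rewrite /= in_itv/= => /andP[cx xd].
have x01 : 0 <= x <= 1 by rewrite (le_trans c0)//= (le_trans (ltW xd)).
by exists (clamp x) => /=; rewrite val_clamp.
Qed.

Lemma measurable_preimage_val1 : measurable (val @^-1` [set 1]).
Proof.
have -> : val @^-1` [set 1] = ~` (val @^-1` `[0, 1[).
  apply/seteqP; split => x /=; rewrite in_itv/=.
    by move=> ->; rewrite ltxx andbF.
  have /andP[-> x1] := unit_itv_valP x => /negP; rewrite -leNgt => ?.
  by apply: le_anti; rewrite x1.
by apply: measurableC; exact: measurable_preimage_val_itv.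
Qed.

Lemma lambda_val_set1 : lambda (val @^-1` [set 1]) = 0%E.
Proof.
apply/eqP; rewrite -measure_le0 -(lebesgue_measure_set1 (1 : R)).
apply: le_measure; rewrite ?inE//.
- exact: measurable_unit_itv_image measurable_preimage_val1.
- by move=> _ [x xE <-].
Qed.

Lemma rho_ub (f g : C_lambda R) x : `|val (f x) - val (g x)| <= rho f g.
Proof.
apply: ub_le_sup; last by exists x.
exists 1 => _ [y _ <-].
have := unit_itv_valP (f y); have := unit_itv_valP (g y).
by move=> /andP[? ?] /andP[? ?]; rewrite ler_norml; apply/andP; split; lra.
Qed.

Lemma rho_le (f g : C_lambda R) e :
  (forall x, `|val (f x) - val (g x)| <= e) -> rho f g <= e.
Proof.
move=> h; apply: ge_sup => [|_ [x _ <-]//].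
by eexists; exists (clamp 0).
Qed.

(** Heine's theorem, by compactness: near each point and for small enough [d]
    the modulus [d] works, hence one [d] works for the whole interval. *)
Lemma uniform_continuity (F : R -> R) e : continuous F -> 0 < e ->
  exists2 d : R, 0 < d & forall x y : R, 0 <= x <= 1 -> 0 <= y <= 1 ->
    `|x - y| < d -> `|F x - F y| < e.
Proof.
move=> cF e0; have := @segment_compact R 0 1.
move=> /compact_near_coveringP /(_ _ (0 : R)^'+
  (fun d x => forall y, `|x - y| < d -> `|F x - F y| < e)) H.
have {H} : \forall d \near (0 : R)^'+, `[0, 1]%classic `<=`
    (fun x => forall y, `|x - y| < d -> `|F x - F y| < e).
  apply: H => x _.
  have /cvgrPdist_lt /(_ (e / 2)) := cF x.
  rewrite divr_gt0// => /(_ isT) /nbhs_ballP[r /= r0 rF].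
  exists (ball x (r / 2), [set d | d < r / 2]).
    split => /=; first by apply: nbhsx_ballx; rewrite divr_gt0.
    by apply: nbhs_right_lt; rewrite divr_gt0.
  move=> [x' d] /= [xx' dr] y x'y.
  rewrite /ball/= in xx'.
  have h1 : `|F x - F x'| < e / 2 by apply: rF; rewrite /ball/=; lra.
  have h2 : `|F x - F y| < e / 2.
    apply: rF; rewrite /ball/= (le_lt_trans (ler_distD x' _ _))//; lra.
  rewrite (le_lt_trans (ler_distD (F x) _ _))// distrC; lra.
move=> near0; near (0 : R)^'+ => d.
exists d => // x y x01 y01 xy.
by apply: (near near0 d) => //=; rewrite ?in_itv.
Unshelve. all: by end_near. Qed.

End unit_itv_transfer.

(** * Maps that nearly permute blocks *)

Section block_tracking.
Variable R : realType.
Local Notation I := (unit_itv R).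
Local Notation val := (@unit_itv_val R).
Implicit Types (A B : set I) (h : C_lambda R).

Lemma bigsetU_ordP (T : Type) N (P : pred 'I_N) (F : 'I_N -> set T) x :
  (\big[setU/set0]_(i < N | P i) F i) x <-> exists2 i, P i & F i x.
Proof.
split=> [|[i Pi Fix]]; last by rewrite (bigD1 i)//=; left.
elim/big_rec: _ => [//|i S Pi IH [Fix|/IH//]].
by exists i.
Qed.

Lemma le_lambda A B : measurable A -> measurable B -> A `<=` B ->
  (lambda A <= lambda B)%E.
Proof. by move=> mA mB AB; apply: le_measure => //; exact: mem_set. Qed.

Lemma lambdaU_le A B : measurable A -> measurable B ->
  (lambda (A `|` B) <= lambda A + lambda B)%E.
Proof. by move=> mA mB; exact: measureU2. Qed.

Lemma lambda_bigsetU_le N (P : pred 'I_N) (F : 'I_N -> set I) :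
  (forall i, measurable (F i)) ->
  (lambda (\big[setU/set0]_(i < N | P i) F i) <=
   \sum_(i < N | P i) lambda (F i))%E.
Proof.
move=> mF; suff [] : measurable (\big[setU/set0]_(i < N | P i) F i) /\
    (lambda (\big[setU/set0]_(i < N | P i) F i) <=
     \sum_(i < N | P i) lambda (F i))%E by [].
elim/big_rec2: _ => [|i s S _ [mS Ss]]; first by rewrite measure0.
split; first exact: measurableU.
by rewrite (le_trans (lambdaU_le _ _))// leeD2l.
Qed.

Lemma iter_preserving h k B : measurable B ->
  measurable (iter k h @^-1` B) /\ lambda (iter k h @^-1` B) = lambda B.
Proof.
elim: k B => [//|k IH] B mB.
have mhB : measurable (h @^-1` B).
  by apply: measurable_preimage_unit_itv => //; exact: C_lambda_continuous.
by have [mk lk] := IH _ mhB; split; rewrite // -C_lambda_preserving// in lk.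
Qed.

(** The exceptional set after [k] steps is the union of the preimages of [bad]
    under the first [k] iterates, each of the measure of [bad] because [h]
    preserves [lambda]. *)
Lemma block_tracking h N (Q : 'I_N -> set I) (s : 'I_N -> 'I_N) bad (b : R) :
  measurable bad -> (lambda bad <= b%:E)%E ->
  (forall i x, Q i x -> ~ bad x -> Q (s i) (h x)) ->
  forall k, exists E, [/\ measurable E, (lambda E <= (k%:R * b)%:E)%E &
    forall i x, Q i x -> ~ E x -> Q (iter k s i) (iter k h x)].
Proof.
move=> mbad lbad Qs; elim=> [|k [E [mE lE QE]]].
  by exists set0; split => //; rewrite measure0 mul0r.
have [mk lk] := iter_preserving h k mbad.
exists (E `|` iter k h @^-1` bad); split.
- exact: measurableU.
- rewrite (le_trans (lambdaU_le _ _))// -natr1 mulrDl mul1r EFinD.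
  by rewrite leeD// lk.
- move=> i x Qix /not_orP[nE nbad] /=; apply: Qs => //; exact: QE.
Qed.

(** When [s] to the power [k] is the identity, the blocks come back to
    themselves after [k] steps, up to the accumulated exceptional set. *)
Lemma block_recurrence h N (Q : 'I_N -> set I) (s : 'I_N -> 'I_N) bad (b : R) k
    (P : pred 'I_N) (A := \big[setU/set0]_(i < N | P i) Q i) :
  (forall i, measurable (Q i)) ->
  measurable bad -> (lambda bad <= b%:E)%E ->
  (forall i x, Q i x -> ~ bad x -> Q (s i) (h x)) ->
  (forall i, iter k s i = i) ->
  (lambda A <= lambda (iter k h @^-1` A `&` A) + (k%:R * b)%:E)%E.
Proof.
move=> mQ mbad lbad Qs sk.
have [E [mE lE QE]] := block_tracking mbad lbad Qs k.
have mA : measurable A by exact: bigsetU_measurable.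
have [mkA _] := iter_preserving h k mA.
have mkAA := measurableI _ _ mkA mA.
apply: (@le_trans _ _ (lambda ((iter k h @^-1` A `&` A) `|` E))).
  apply: le_lambda => //; first exact: measurableU.
  move=> x Ax; have [Ex|nEx] := pselect (E x); [by right|left; split => //].
  move: Ax => /bigsetU_ordP[i Pi Qix]; apply/bigsetU_ordP; exists i => //.
  by rewrite -(sk i); exact: QE.
by rewrite (le_trans (lambdaU_le _ _))// leeD2l.
Qed.

End block_tracking.

(** * Block permutations carried by a measure-preserving map *)

Section blocks.
Variable R : realType.
Local Notation I := (unit_itv R).
Local Notation val := (@unit_itv_val R).

Definition block N (i : nat) : set I :=
  val @^-1` `[i%:R / N%:R, i.+1%:R / N%:R[.

Lemma measurable_block N i : measurable (block N i).
Proof. exact: measurable_preimage_val_itv. Qed.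

Lemma lambda_block N i : (i < N)%N -> lambda (block N i) = (N%:R^-1)%:E.
Proof.
move=> iN; have N0 : 0 < N%:R :> R by rewrite ltr0n (leq_ltn_trans _ iN).
rewrite lambda_val_itv.
- by rewrite -natr1 mulrDl mul1r addrC addKr.
- by rewrite divr_ge0.
- by rewrite ler_pM2r ?invr_gt0// ler_nat.
- by rewrite ler_pdivrMr// mul1r ler_nat.
Qed.

Lemma block_cover N x : val x < 1 -> exists i : 'I_N.+1, block N.+1 i x.
Proof.
move=> x1; have /andP[x0 _] := unit_itv_valP x.
have N0 : 0 < N.+1%:R :> R by rewrite ltr0n.
have xN0 : 0 <= val x * N.+1%:R by rewrite mulr_ge0.
have /andP[h1 h2] := truncn_itv xN0.
have iN : (Num.truncn (val x * N.+1%:R) < N.+1)%N.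
  rewrite -(ltr_nat R) (le_lt_trans h1)// -[ltRHS]mul1r ltr_pM2r//.
exists (Ordinal iN); rewrite /block/= in_itv/=.
by rewrite ler_pdivrMr// ltr_pdivlMr// h1.
Qed.

Lemma block_inj N i j x : block N i x -> block N j x -> i = j.
Proof.
have [->|N0] := eqVneq N 0%N.
  rewrite /block/= !in_itv/= invr0 !mulr0 => /andP[/le_lt_trans h /h].
  by rewrite ltxx.
have {}N0 : 0 < N%:R :> R by rewrite ltr0n lt0n.
rewrite /block/= !in_itv/= => /andP[ix xi] /andP[jx xj].
have := le_lt_trans ix xj; have := le_lt_trans jx xi.
by rewrite !ltr_pM2r ?invr_gt0// !ltr_nat; lia.
Qed.

Lemma lambda_blocks N (P : pred 'I_N) :
  lambda (\big[setU/set0]_(i < N | P i) block N i) = (#|P|%:R / N%:R)%:E.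
Proof.
rewrite measure_bigsetU_ord//=.
- rewrite (eq_bigr (fun=> (N%:R^-1)%:E)); last first.
    by move=> i _; rewrite lambda_block.
  by rewrite sumEFin sumr_const mulr_natl.
- by move=> i; exact: measurable_block.
- by apply/trivIsetP => i j _ _ ij; apply/seteqP; split => // x [/= xi xj];
    move: ij; rewrite (val_inj (block_inj xi xj)) eqxx.
Qed.

(** Hall's condition holds because [f] preserves measure: the blocks in [A] lie,
    up to a null set, in the preimage of the blocks that [f] reaches from them,
    and all blocks have the same measure. *)
Lemma block_permutation (f : C_lambda R) N :
  exists s : {perm 'I_N}, forall i : 'I_N,
    exists2 x, block N i x & block N (s i) (f x).
Proof.
case: N => [|N]; first by exists 1%g => -[].
pose e (i j : 'I_N.+1) := `[< exists2 x, block N.+1 i x & block N.+1 j (f x) >].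
pose full := [set: 'I_N.+1]%SET.
have [|s si se] := @hall_marriage _ _ e ord0 full full.
  move=> A _; rewrite finset.setIT.
  pose S (B : {set 'I_N.+1}) :=
    \big[setU/set0]_(i < N.+1 | i \in B) block N.+1 i.
  have mS B : measurable (S B).
    by apply: bigsetU_measurable => i _; exact: measurable_block.
  (* Half-open blocks miss the right endpoint, which has to be added. *)
  pose T := S (neighbours e A) `|` val @^-1` [set 1].
  have m1 := @measurable_preimage_val1 R.
  have mT : measurable T by exact: measurableU.
  have : (lambda (S A) <= lambda (S (neighbours e A)))%E.
    apply: (@le_trans _ _ (lambda (f @^-1` T))).
      apply: le_lambda => //.
        apply: measurable_preimage_unit_itv => //.
        exact: C_lambda_continuous.
      move=> x /bigsetU_ordP[i iA xi].
      have /andP[_] := unit_itv_valP (f x).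
      rewrite le_eqVlt => /orP[/eqP fx1|fx1]; [by right|left].
      have [j fxj] := block_cover N fx1; apply/bigsetU_ordP; exists j => //.
      by apply/neighboursP; exists i => //; apply/asboolP; exists x.
    rewrite -C_lambda_preserving// (le_trans (lambdaU_le _ _))//.
    by rewrite lambda_val_set1 adde0.
  by rewrite !lambda_blocks lee_fin ler_pM2r ?invr_gt0 ?ltr0n// ler_nat.
have sinj : injective s by move=> i j; apply: si; rewrite inE.
exists (perm sinj) => i; rewrite permE.
by have /andP[/asboolP] := se i (finset.in_setT i).
Qed.

End blocks.

(** * Approximation by robustly recurrent maps *)

Section approximation.
Variable R : realType.
Local Notation I := (unit_itv R).
Local Notation val := (@unit_itv_val R).
Implicit Types (f g h : C_lambda R).

Definition extend f (x : R) : R := val (f (clamp x)).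

Lemma continuous_extend f : continuous (extend f).
Proof.
move=> x; apply: (@continuous_comp _ _ _ (f \o @clamp R) val).
  apply: continuous_comp; first exact: continuous_clamp.
  exact: C_lambda_continuous.
exact: continuous_val.
Qed.

Lemma extend_bounds f x : 0 <= extend f x <= 1.
Proof. exact: unit_itv_valP. Qed.

Lemma extend_preserving f (A : set I) : measurable A ->
  occupation (extend f) 0 1 (val @` A) = occupation id 0 1 (val @` A).
Proof.
move=> mA; apply: EFin_inj; rewrite -lambdaE// (C_lambda_preserving f)//.
apply/esym/lambda_preimage => //; first exact: C_lambda_continuous.
  exact: continuous_extend.
by move=> x; rewrite /extend clamp_val.
Qed.

Lemma grid_cover N (x : R) : 0 <= x <= 1 -> exists i : 'I_N.+1,
  i%:R / N.+1%:R <= x <= i.+1%:R / N.+1%:R.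
Proof.
move=> x01; have /andP[x0] := x01; rewrite le_eqVlt => /orP[/eqP ->|x1].
  exists ord_max => /=; rewrite divff ?lexx ?andbT//.
  by rewrite ler_pdivrMr// mul1r ler_nat.
have [|i] := @block_cover R N (clamp x); first by rewrite val_clamp.
rewrite /block/= val_clamp// in_itv/= => /andP[xi /ltW ix].
by exists i; rewrite xi.
Qed.

(** Inserting in the [i]-th cell a loop over the block [s i] keeps the map close
    to [f], as the cell and the block are small and [f] joins them. The result
    preserves measure because [s] is a permutation: the loops together cover
    the blocks once each. *)
Lemma loop_approximation f (e eta : R) N (s : {perm 'I_N.+1}) :
  0 < eta < 1 ->
  (forall x y : R, 0 <= x <= 1 -> 0 <= y <= 1 -> `|x - y| <= N.+1%:R^-1 ->
     `|extend f x - extend f y| <= e) ->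
  (forall i : 'I_N.+1, exists2 x, block N.+1 i x & block N.+1 (s i) (f x)) ->
  exists g : C_lambda R, exists G : R -> R,
  [/\ rho f g <= e + N.+1%:R^-1, continuous G,
      (forall x, val (g x) = G (val x)) &
      forall (i : 'I_N.+1) B, measurable B ->
      occupation G (i%:R / N.+1%:R) (i.+1%:R / N.+1%:R) B =
      eta * occupation (extend f) (i%:R / N.+1%:R) (i.+1%:R / N.+1%:R) B +
      (1 - eta) *
        occupation id ((s i)%:R / N.+1%:R) ((s i).+1%:R / N.+1%:R) B].
Proof.
move=> eta01 osc fs; pose w : R := N.+1%:R^-1.
have w0 : 0 < w by rewrite invr_gt0.
have dE (i : nat) : i.+1%:R * w = i%:R * w + w by rewrite -natr1 mulrDl mul1r.
have zP i : exists z, (i%:R * w <= z <= i.+1%:R * w) /\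
    forall iN : (i < N.+1)%N,
      (s (Ordinal iN))%:R * w <= extend f z <= (s (Ordinal iN)).+1%:R * w.
  have [iN|iN] := pselect (i < N.+1)%N; last first.
    exists (i%:R * w); split; first by rewrite lexx dE lerDl ltW.
    by move=> iN'; exfalso; exact: iN.
  have [x xi fxi] := fs (Ordinal iN); exists (val x); split.
    by move: xi; rewrite /block/= in_itv/= => /andP[-> /ltW ->].
  move=> iN'; move: fxi; rewrite /block/= in_itv/= => /andP[h1 /ltW h2].
  rewrite /extend clamp_val (_ : Ordinal iN' = Ordinal iN) ?h1//.
  exact: val_inj.
have [z zE] := choice zP.
pose u (i : nat) : R := (s (inord i))%:R * w.
have uE (i : 'I_N.+1) : u i = (s i)%:R * w by rewrite /u inord_val.
have u1E (i : 'I_N.+1) : u i + w = (s i).+1%:R * w by rewrite uE dE.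
have := @insert_loops R (extend f) w eta N.+1 z u (@continuous_extend f) w0.
case=> //.
- by move=> i _; case: (zE i).
- move=> i iN; have [_ /(_ iN)] := zE i.
  by rewrite -u1E -uE.
move=> G [cG rG oG].
have i01 (i : 'I_N.+1) : 0 <= i%:R * w /\ i.+1%:R * w <= 1.
  by split; [rewrite mulr_ge0// ltW|rewrite ler_pdivrMr// mul1r ler_nat].
have in01 (i : 'I_N.+1) x : i%:R * w <= x <= i.+1%:R * w -> 0 <= x <= 1.
  move=> /andP[x1 x2]; have [h1 h2] := i01 i.
  by rewrite (le_trans h1)//= (le_trans x2).
have G01 x : 0 <= x <= 1 -> 0 <= G x <= 1.
  move=> /(grid_cover N)[i xi].
  have [[y _ ->]|] := rG i x (ltn_ord i) xi; first exact: extend_bounds.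
  rewrite u1E uE => /andP[h1 h2]; apply: (in01 (s i)).
  by rewrite h1.
pose g (x : I) : I := clamp (G (val x)).
have gE x : val (g x) = G (val x) by rewrite val_clamp// G01// unit_itv_valP.
have cg : continuous g.
  move=> x; apply: (@continuous_comp _ _ _ (G \o val) (@clamp R)).
    by apply: continuous_comp; [exact: continuous_val|exact: cG].
  exact: continuous_clamp.
have oGE (i : 'I_N.+1) B : measurable B ->
    occupation G (i%:R * w) (i.+1%:R * w) B =
    eta * occupation (extend f) (i%:R * w) (i.+1%:R * w) B +
    (1 - eta) * occupation id ((s i)%:R * w) ((s i).+1%:R * w) B.
  by move=> mB; rewrite oG// -u1E -uE.
have Nw : 1 = N.+1%:R * w :> R by rewrite divff.
have cid : continuous (@id R) by move=> ?.
have pg (A : set I) : measurable A -> lambda A = lambda (g @^-1` A).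
  move=> mA; have mvA := measurable_unit_itv_image mA.
  rewrite lambdaE// (lambda_preimage cg cG mA gE); congr EFin.
  rewrite [in RHS]Nw occupation_grid ?(ltW w0)//.
  rewrite (eq_bigr _ (fun i _ => oGE i _ mvA)) big_split/= -!mulr_sumr.
  rewrite -occupation_grid ?(ltW w0)//; last exact: continuous_extend.
  rewrite -Nw extend_preserving//.
  have -> : \sum_(i < N.+1)
      occupation id ((s i)%:R * w) ((s i).+1%:R * w) (val @` A) =
    \sum_(i < N.+1) occupation id (i%:R * w) (i.+1%:R * w) (val @` A).
    by rewrite [RHS](reindex_inj (@perm_inj _ s)).
  rewrite -occupation_grid ?(ltW w0)// -Nw; ring.
exists (MkClambda cg pg), G; split => //.
apply: rho_le => x /=.
have vx := unit_itv_valP x; rewrite gE.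
have fE : val (f x) = extend f (val x) by rewrite /extend clamp_val.
rewrite fE; have [i xi] := grid_cover N vx.
have near y : i%:R * w <= y <= i.+1%:R * w -> `|val x - y| <= w.
  move: xi; rewrite -/w dE => /andP[? ?] /andP[? ?].
  by rewrite ler_norml; apply/andP; split; lra.
have [[y yi ->]|] := rG i _ (ltn_ord i) xi.
  rewrite (le_trans (osc _ _ vx (in01 _ _ yi) (near _ yi)))//.
  by rewrite lerDl ltW.
have [zi /(_ (ltn_ord i))] := zE i.
rewrite (_ : Ordinal _ = i); last exact: val_inj.
rewrite -u1E -uE => fz Gx.
rewrite (le_trans (ler_distD (extend f (z i)) _ _))// lerD//.
  by apply: osc => //; [exact: in01 zi|exact: near].
move: fz Gx => /andP[? ?] /andP[? ?].
by rewrite -/w ler_norml; apply/andP; split; lra.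
Qed.

(** Only one step of the perturbed map [h] is compared with [g]. A point of the
    [i]-th block that [h] does not send to the [j]-th one is sent by [g] outside
    of the [j]-th block shrunk by [delta] at both ends: either it is in the fast
    part of [g], or the loop has it in a margin. *)
Lemma block_leak f g h (G : R -> R) eta delta N (i j : 'I_N) :
  continuous G -> (forall x, val (g x) = G (val x)) ->
  0 < eta < 1 -> 0 < delta -> 2 * delta <= N%:R^-1 ->
  (forall B, measurable B ->
      occupation G (i%:R / N%:R) (i.+1%:R / N%:R) B =
      eta * occupation (extend f) (i%:R / N%:R) (i.+1%:R / N%:R) B +
      (1 - eta) * occupation id (j%:R / N%:R) (j.+1%:R / N%:R) B) ->
  rho g h < delta ->
  (lambda (block N i `\` h @^-1` block N j) <=
     (eta * N%:R^-1 + 2 * delta)%:E)%E.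
Proof.
move=> cG gE /andP[eta0 eta1] d0 dN oG gh.
have N0 : 0 < N%:R :> R by rewrite ltr0n (leq_ltn_trans _ (ltn_ord i)).
pose w : R := N%:R^-1; have w0 : 0 < w by rewrite invr_gt0.
have dE (k : nat) : k.+1%:R / N%:R = k%:R / N%:R + w.
  by rewrite -natr1 mulrDl mul1r.
pose u : R := j%:R / N%:R.
pose C := ~` `[u + delta, u + w - delta[%classic.
have mC : measurable C by apply: measurableC.
have cid : continuous (@id R) by move=> ?.
have mD : measurable (block N i `\` h @^-1` block N j).
  apply: measurableD; first exact: measurable_block.
  apply: measurable_preimage_unit_itv; first exact: C_lambda_continuous.
  exact: measurable_block.
apply: (@le_trans _ _ (occupation G (i%:R / N%:R) (i.+1%:R / N%:R) C)%:E).
  rewrite occupationE//; apply: le_measure.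
  - by apply: mem_set; exact: (measurable_unit_itv_image mD).
  - by apply: mem_set; exact: occupation_measurable.
  move=> _ [x [xi nhx] <-]; split => //= Gx; apply: nhx.
  have := le_lt_trans (rho_ub g h x) gh; rewrite gE ltr_norml => /andP[h1 h2].
  move: Gx; rewrite /block/= !in_itv/= -/u => /andP[h3 h4].
  by rewrite dE -/u; apply/andP; split; lra.
rewrite lee_fin oG// dE; apply: lerD.
  rewrite ler_pM2l//; set c := i%:R / N%:R.
  have cw : c <= c + w by rewrite lerDl ltW.
  have := occupation_le_length (@continuous_extend f) mC cw.
  by rewrite -/w; lra.
rewrite -/w in dN; rewrite (@le_trans _ _ (occupation id u (u + w) C))//.
  by rewrite -/u dE -/u ler_piMl ?occupation_ge0//; lra.
rewrite (@occupation_split _ _ _ (u + delta))//; [|lra|lra].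
rewrite (@occupation_split _ _ (u + delta) (u + w - delta))//; [|lra|lra].
have -> : occupation id (u + delta) (u + w - delta) C = 0.
  rewrite /occupation (_ : _ `&` _ = set0) ?measure0//.
  by apply/seteqP; split => // x [xi /=].
have := @occupation_le_length R id u (u + delta) C cid mC.
have := @occupation_le_length R id (u + w - delta) (u + w) C cid mC.
lra.
Qed.

Definition left_half : set I := val @^-1` `[0, 2^-1[.

Lemma lambda_left_half : lambda left_half = (2^-1)%:E.
Proof. by rewrite lambda_val_itv ?subr0//; lra. Qed.

(** The order of choices matters: the mesh gives the permutation, which gives
    the return time [k], and only then is the loss per step made small compared
    with [1 / k]. *)
Lemma robust_recurrence f (e : R) n : 0 < e ->
  exists g : C_lambda R, rho f g < e /\
  exists2 delta : R, 0 < delta & forall h, rho g h < delta ->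
    exists2 k, (n <= k)%N &
      ((3^-1)%R%:E < lambda (iter k h @^-1` left_half `&` left_half))%E.
Proof.
move=> e0.
have e4 : 0 < e / 4 by rewrite divr_gt0.
have [d d0 dF] := uniform_continuity (@continuous_extend f) e4.
pose m := Num.min d (e / 4).
have m0 : 0 < m by rewrite lt_min d0.
pose M := (Num.truncn m^-1).+1.
have MP : m^-1 < M%:R :> R by exact: truncnS_gt.
have M0 : 0 < M%:R :> R by rewrite ltr0n.
(* An even number of blocks, so that the left half is a union of blocks. *)
pose N := (M.*2).-1.
have NE : N.+1 = M.*2 by rewrite /N prednK// double_gt0.
have NR : N.+1%:R = 2 * M%:R :> R by rewrite NE -mul2n natrM.
have wm : N.+1%:R^-1 < m.
  rewrite -[ltRHS]invrK ltf_pV2 ?posrE ?invr_gt0 ?ltr0n//.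
  by rewrite (lt_trans MP)// NR; lra.
have [s sP] := block_permutation f N.+1.
pose k := (#[s]%g * n.+1)%N.
have s_gt0 : (0 < #[s]%g)%N by exact: order_gt0.
have nk : (n <= k)%N by rewrite /k; nia.
have k0 : 0 < k%:R :> R by rewrite ltr0n /k; lia.
have k1 : 1 <= k%:R :> R by rewrite ler1n -(ltr0n R).
have sk i : iter k s i = i by rewrite -permX expgM expg_order expg1n perm1.
(* One step then loses at most [2 * eta], and [k] steps lose at most
   [1 / 12 < 1 / 2 - 1 / 3]. *)
pose eta : R := (24 * k%:R)^-1.
have eta01 : 0 < eta < 1.
  by rewrite invr_gt0 mulr_gt0//= invf_lt1 ?mulr_gt0//; lra.
pose w : R := N.+1%:R^-1.
have w0 : 0 < w by rewrite invr_gt0.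
pose delta : R := eta * w / 2.
have delta0 : 0 < delta by rewrite divr_gt0// mulr_gt0//; case/andP: eta01.
have dw : 2 * delta <= w.
  rewrite /delta mulrC divfK// ger_pMl//; lra.
have osc (x y : R) : 0 <= x <= 1 -> 0 <= y <= 1 -> `|x - y| <= w ->
    `|extend f x - extend f y| <= e / 4.
  move=> x01 y01 xy; apply/ltW/dF => //; rewrite (le_lt_trans xy)//.
  by rewrite (lt_le_trans wm)// ge_min lexx.
have [g [G [fg cG gE oG]]] := loop_approximation eta01 osc sP.
exists g; split.
  have : w < e / 4 by rewrite (lt_le_trans wm)// ge_min lexx orbT.
  by move=> we; apply: (le_lt_trans fg); rewrite -/w; lra.
exists delta => // h gh; exists k => //.
pose P := [pred i : 'I_N.+1 | (i < M)%N].
pose bad := \big[setU/set0]_(i < N.+1 | true)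
  (block N.+1 i `\` h @^-1` block (R := R) N.+1 (s i)).
have mleak (i : 'I_N.+1) :
    measurable (block N.+1 i `\` h @^-1` block (R := R) N.+1 (s i)).
  apply: measurableD; first exact: measurable_block.
  apply: measurable_preimage_unit_itv; first exact: C_lambda_continuous.
  exact: measurable_block.
have mbad : measurable bad by exact: bigsetU_measurable.
have lbad : (lambda bad <= (2 * eta)%:E)%E.
  rewrite (le_trans (lambda_bigsetU_le _ mleak))//.
  rewrite (@le_trans _ _ (\sum_(i < N.+1) (2 * eta * w)%:E)%E)//.
    apply: lee_sum => i _.
    have := block_leak cG gE eta01 delta0 dw (oG i) gh.
    by rewrite -/w (_ : eta * w + 2 * delta = 2 * eta * w)// /delta; field.
  rewrite sumEFin sumr_const card_ord.
  by rewrite -(mulr_natr (2 * eta * w)) /w mulfVK.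
have badP (i : 'I_N.+1) x : block N.+1 i x -> ~ bad x -> block N.+1 (s i) (h x).
  move=> xi; apply: contra_notP => hx; apply/bigsetU_ordP; exists i => //.
have left_halfE : \big[setU/set0]_(i < N.+1 | P i) block (R := R) N.+1 i =
    left_half.
  rewrite /left_half; apply/seteqP; split => x.
    move=> /bigsetU_ordP[i /= iM]; rewrite /block/= !in_itv/= => /andP[_ xi].
    have /andP[-> _]/= := unit_itv_valP x; rewrite (lt_le_trans xi)//.
    rewrite ler_pdivrMr// NR mulrA mulVf// mul1r ler_nat//.
  rewrite /= in_itv/= => /andP[x0 x2].
  have [|i xi] := @block_cover R N x; first by lra.
  apply/bigsetU_ordP; exists i => //=; rewrite -(ltr_nat R).
  move: xi; rewrite /block/= in_itv/= => /andP[+ _].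
  rewrite ler_pdivrMr// NR => xi; rewrite (le_lt_trans xi)//.
  by rewrite mulrA -[ltRHS]mul1r ltr_pM2r//; lra.
have := @block_recurrence R h _ _ _ _ _ _ P
  (fun i => @measurable_block R N.+1 i) mbad lbad badP sk.
rewrite left_halfE lambda_left_half.
rewrite (_ : k%:R * (2 * eta) = 12^-1); last first.
  by rewrite /eta; field; rewrite gt_eqF.
set B := iter k h @^-1` left_half `&` left_half.
case: (lambda B) (measure_ge0 (@lambda R) B).
- move=> r _; rewrite -EFinD !lee_fin lte_fin; lra.
- by rewrite ltry.
- by [].
Qed.

End approximation.

Theorem theorem20 (R : realType) :
  meager [set f : C_lambda R | strongly_mixing f].
Proof.
pose A : set (unit_itv R) := @left_half R.
(* The threshold [1 / 3] lies between [1 / 4], the limit for a strongly mixing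
   map, and [1 / 2], the value for a map whose iterate fixes [A]. *)
pose F n := [set f : C_lambda R | strongly_mixing f /\
  forall k, (n <= k)%N -> (lambda (iter k f @^-1` A `&` A) <= (3^-1)%R%:E)%E].
exists F; split=> [n|].
  apply/seteqP; split => // f.
  rewrite /interior => /nbhs_ballP[e /= e0 ball_F].
  have [g [fg [delta delta0 hP]]] := robust_recurrence f n e0.
  have /(_ (ball g delta)) : closure (F n) g.
    by apply: ball_F; rewrite ballEmdist.
  case; first exact: nbhsx_ballx.
  move=> h [[_ Fh]]; rewrite ballEmdist/= => gh.
  have [k nk] := hP h gh.
  by rewrite ltNge => /negP; apply; exact: Fh.
apply/seteqP; split => [f mf|f [n _ []]//].
have mA : measurable A by exact: measurable_preimage_val_itv.
have lA : lambda A = (2^-1)%:E by exact: lambda_left_half.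
have := mf A A mA mA; rewrite lA -EFinM => cvA.
have : \forall n \near \oo, (lambda (iter n f @^-1` A `&` A) < (3^-1)%R%:E)%E.
  apply: (cvA [set x | (x < (3^-1)%R%:E)%E]).
  apply: open_nbhs_nbhs; split; first exact: open_ereal_lt_ereal.
  by rewrite /= lte_fin; lra.
move=> [n _ nP]; exists n => //; split => // k nk.
by apply/ltW/nP.
Qed.
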